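(* Let $l$, $n$ and $d\geqslant n$ be positive integers. Then every word over an $l$-letter ordered alphabet of length at least $\Psi(n,d,l)$ either contains a subword of the form $x^d$ with $x$ a nonempty word, or is $n$-divisible, where $$\Psi(n,d,l)=256\, l\,(nd)^{2\log_2(nd)+10}\,d^2.$$
   Context: Words are finite words over an alphabet $a_1\prec a_2\prec\dots\prec a_l$; a subword is a contiguous factor. The order on letters induces the (partial) lexicographic order on words: two words, one of which is a prefix of the other, are called incomparable; otherwise the words are compared by the letters at the first position where they differ. The notation $u\succ v$ means that $u$ and $v$ are comparable and $u$ is lexicographically larger than $v$. A word $W$ is $n$-divisible if it can be written as $W=vu_1u_2\cdots u_n$ with words $v,u_1,\dots,u_n$ such that $u_1\succ u_2\succ\dots\succ u_n$. *)

(* Defs.v *)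
From HB Require Import structures.
From mathcomp Require Import all_boot all_order all_algebra.
From mathcomp Require Import reals exp.

Set Implicit Arguments.
Unset Strict Implicit.
Unset Printing Implicit Defensive.

Import Order.TTheory GRing.Theory Num.Theory.

Section Words.
Context {disp : Order.disp_t} {A : orderType disp}.
Implicit Types (u v x W : seq A).

Definition wcomparable u v : bool := ~~ prefix u v && ~~ prefix v u.

(* The library's [seqlexi] is the total lexicographic order, in which a proper
   prefix is smaller; it is used only on words neither of which is a prefix of
   the other, where it is decided by the first position at which they differ. *)
Definition wgt u v : bool :=
  wcomparable u v && ((v : seqlexi A) < (u : seqlexi A))%O.

Definition wpow x (d : nat) : seq A := flatten (nseq d x).

Definition contains_power (d : nat) W : Prop :=
  exists2 x : seq A, x != [::] & infix (wpow x d) W.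

(* [v] may be empty; for n >= 2 the blocks [us] are nonempty because the empty
   word is a prefix of every word. *)
Definition n_divisible (n : nat) W : Prop :=
  exists (v : seq A) (us : n.-tuple (seq A)),
    W = v ++ flatten us /\ sorted wgt us.

Lemma wgt_cons a b u v :
  wgt (a :: u) (b :: v) = (b < a)%O || ((a == b) && wgt u v).
Proof.
rewrite /wgt /wcomparable !prefix_cons ltxi_cons.
by case: (ltgtP a b).
Qed.

Lemma wgtP u v :
  reflect (exists p a b s t,
             [/\ u = p ++ a :: s, v = p ++ b :: t & (b < a)%O])
          (wgt u v).
Proof.
apply: (iffP idP) => [|[p [a [b [s [t [-> -> lt_ba]]]]]]]; last first.
  by elim: p => [|c p IHp]; rewrite /= wgt_cons ?lt_ba // eqxx IHp orbT.
elim: u v => [|a u IHu] [|b v] //; rewrite wgt_cons.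
case/orP=> [lt_ba|/andP[/eqP<- /IHu[p [c [e [s [t [-> -> lt_ec]]]]]]]].
  by exists [::], a, b, u, v.
by exists (a :: p), c, e, s, t.
Qed.

End Words.

Local Open Scope ring_scope.

Definition log2 {R : realType} (x : R) : R := ln x / ln 2.

Definition Psi (R : realType) (n d l : nat) : R :=
  256 * l%:R * ((n * d)%:R `^ (2 * log2 (n * d)%:R + 10)) * d%:R ^+ 2.

(* Main.v *)
Require Import Defs.
From HB Require Import structures.
From mathcomp Require Import all_boot all_order all_algebra.
From mathcomp Require Import boolp reals exp.
From mathcomp Require Import zify.

Import Order.TTheory GRing.Theory Num.Theory.

(** Fix a window length [K = 2 ^ j >= n * d], and call a pair of positions
    [i], [i'] with [i + K <= i'] a far drop if the length-[K] factor at [i] is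
    lexicographically larger than the one at [i'].  Cutting the word along a
    chain of far drops through [n] positions gives an [n]-division, since each
    comparison is decided within the first [K] letters of both blocks
    ([divisible_of_chain]).  If the word is not [n]-divisible, such chains are
    short, so the positions can be coloured with [n - 1] colours such that no far
    drop has both ends of the same colour ([colouring]): along each colour the
    length-[K] factors, and all their prefixes, can only increase, up to local
    perturbations at distance less than [K].

    Call an interval of positions [k]-uniform if positions of the same colour
    start the same factor of length [k].  In a [k]-uniform interval there are at
    most [n - 1] factors of length [k], so a factor of length [2 k] is determined
    by two colours, the one of its start and the one of its middle, out of
    [(n - 1) ^ 2] pairs.  Choose [n ^ 2] blocks in the interval, with gaps of
    length at least [K].  A block that is not [2 k]-uniform contains two positions
    of the same colour with different factors of length [2 k]; by monotonicity,
    the larger of the two factors is smaller than the corresponding one in any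
    later block where this happens with the same colour.  Pairs of colours thus
    distinguish the bad blocks, and some block is [2 k]-uniform
    ([uniform_double]).  A [1]-uniform block is found in the whole word in the
    same way, with pairs of a colour and a letter ([uniform_letter]); this is
    where the size of the alphabet enters, as a linear factor.  Each doubling of
    [k] costs a factor [2 * n ^ 2] in length, and about [log2 (n d)] doublings
    are needed, which gives the quasi-polynomial bound.

    In a [K]-uniform interval of length [K * n ^ 2], some factor [u] of length
    [K >= n * d] has [n] disjoint occurrences.  Any two of the [n] longest
    suffixes of [u] are comparable, unless the longer one has a period so short
    that it starts with a [d]-th power.  So, in the absence of [d]-th powers,
    taking the largest of these suffixes in the first occurrence of [u], the next
    one in the second, and so on, gives an [n]-division ([uniform_full]). *)

Section Combinatorics.
Local Open Scope nat_scope.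
Set Implicit Arguments.
Unset Strict Implicit.

(** * Longest paths and pigeonholes *)

(** The colour of [x] is the length of the longest path that starts at [x]; it
    strictly decreases along each edge. *)
Lemma longest_path_colouring (T : Type) (e : rel T) (p : nat) :
  (forall x s, size s = p.+1 -> ~~ path e x s) ->
  exists col : T -> 'I_p.+1, forall x y, e x y -> col x != col y.
Proof.
move=> short.
pose reach x c := `[< exists2 s, size s = c & path e x s >].
have reach0 x : exists c, reach x c by exists 0; apply/asboolP; exists [::].
have reach_le x c : reach x c -> c <= p.
  move=> /asboolP[s <- es]; rewrite leqNgt; apply/negP => lt_ps.
  have /negP[] := short x (take p.+1 s) (size_takel lt_ps).
  exact: take_path.
pose height x := ex_maxn (reach0 x) (@reach_le x).
have height_le x : height x < p.+1.
  by rewrite /height; case: ex_maxnP => c /reach_le.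
exists (fun x => Ordinal (height_le x)) => x y exy.
suff: height y < height x by rewrite -val_eqE /= => lt; rewrite gtn_eqF.
rewrite /height; case: (ex_maxnP (reach0 y)) => c /asboolP[s <- es] _.
case: (ex_maxnP (reach0 x)) => c' _; apply.
by apply/asboolP; exists (y :: s) => //=; rewrite exy.
Qed.

Lemma frequent_value (S : eqType) (T : finType) (f : S -> T) (m : nat) s :
  #|T| * m < size s -> exists c, m < count (fun x => f x == c) s.
Proof.
have -> : size s = \sum_(c : T) count (fun x => f x == c) s.
  elim: s => [|x s IHs] /=; first by rewrite big1.
  rewrite big_split /= -IHs (bigD1 (f x)) //= eqxx big1 ?addn0 ?add1n //.
  by move=> c; rewrite eq_sym => /negPf->.
move=> lt_m; case: (pickP (fun c => m < count (fun x => f x == c) s)) => [c|none].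
  by exists c.
move: lt_m; rewrite ltnNge -sum_nat_const leq_sum // => c _.
by rewrite leqNgt none.
Qed.

(** * Lexicographic comparison and periodic words *)

Context {disp : Order.disp_t} {A : finOrderType disp}.
Implicit Types (u v t W : seq A).

Lemma wgt_cat u v s t : wgt u v -> wgt (u ++ s) (v ++ t).
Proof.
case/wgtP => p [a [b [s' [t' [-> -> lt_ba]]]]].
by apply/wgtP; exists p, a, b, (s' ++ s), (t' ++ t); split; rewrite -?catA.
Qed.

Lemma wgt_take k u v : wgt (take k u) (take k v) -> wgt u v.
Proof.
by move=> /(wgt_cat (drop k u) (drop k v)); rewrite !cat_take_drop.
Qed.

Lemma wgt_total u v : size u = size v -> u != v -> wgt u v || wgt v u.
Proof.
elim: u v => [|a u IHu] [|b v] //= [eq_sz]; rewrite eqseq_cons !wgt_cons.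
by case: (ltgtP a b) => //= _; apply: IHu.
Qed.

(** A word that starts with its own suffix from offset [k] has period [k]. *)
Lemma prefix_period u k d : prefix (drop k u) u -> d * k <= size u ->
  prefix (wpow (take k u) d) u.
Proof.
move=> per; elim: d => [|d IHd] le_dk; first exact: prefix0s.
have le_ku : k <= size u by lia.
have {IHd} pre_d : prefix (wpow (take k u) d) u by apply: IHd; lia.
rewrite -{2}(cat_take_drop k u) /wpow /= prefix_catr // -/(wpow _ d).
have sz_pow : size (wpow (take k u) d) = d * k.
  by rewrite /wpow size_flatten /shape map_nseq sumn_nseq size_takel // mulnC.
move: per; rewrite !prefixE in pre_d * => /eqP per.
rewrite -per take_takel ?(eqP pre_d) ?eqxx // sz_pow size_drop.
by rewrite leq_subRL // -mulSn.
Qed.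

(** If the shorter tail were a prefix of the longer one, the longer one would have
    period [j - i], and its length is at least [d * (j - i)]. *)
Lemma comparable_tails u n d i j :
  ~ contains_power d u -> 0 < d -> n * d <= size u -> i < j < n ->
  wcomparable (drop i u) (drop j u).
Proof.
move=> nopow d0 le_nd /andP[lt_ij lt_jn].
have le_jd : j.+1 * d <= size u by apply: leq_trans le_nd; rewrite leq_mul2r lt_jn orbT.
have le_ju : j < size u by apply: leq_trans le_jd; rewrite leq_pmulr.
rewrite /wcomparable; apply/andP; split.
  by apply/negP => /size_prefix; rewrite !size_drop leqNgt ltn_sub2l // (ltn_trans lt_ij).
apply/negP => per; apply: nopow.
have eq_j : drop j u = drop (j - i) (drop i u) by rewrite drop_drop subnK // ltnW.
exists (take (j - i) (drop i u)).
  have: 0 < size (take (j - i) (drop i u)).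
    by rewrite size_takel ?size_drop; clear - lt_ij le_ju; lia.
  by case: (take _ _).
have: prefix (wpow (take (j - i) (drop i u)) d) (drop i u).
  by apply: prefix_period; rewrite -?eq_j // size_drop; clear - le_jd d0 lt_ij; nia.
by move/prefix_infix_trans; apply; apply: infix_drop.
Qed.

Lemma decreasing_tails u n d :
  ~ contains_power d u -> 0 < d -> n * d <= size u ->
  exists ts : seq (seq A),
    [/\ size ts = n, sorted wgt ts & all (fun t => suffix t u) ts].
Proof.
move=> nopow d0 le_nd.
(* On pairwise comparable words, the library's total order agrees with [wgt]. *)
pose tails : seq (seqlexi A) := [seq drop i u | i <- iota 0 n].
have cmp i j : i < n -> j < n -> i != j -> wcomparable (drop i u) (drop j u).
  move=> lt_in lt_jn; rewrite neq_ltn => /orP[lt_ij|lt_ji].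
    by apply: comparable_tails nopow d0 le_nd _; rewrite lt_ij.
  rewrite /wcomparable andbC.
  by apply: comparable_tails nopow d0 le_nd _; rewrite lt_ji.
have uniq_tails : uniq tails.
  rewrite map_inj_in_uniq ?iota_uniq // => i j; rewrite !mem_iota !add0n /= => lt_in lt_jn.
  apply: contra_eq => neq; have := cmp _ _ lt_in lt_jn neq.
  by apply: contraTneq => ->; rewrite /wcomparable prefix_refl.
pose ts := rev (sort <=%O tails).
have mem_ts t : t \in ts -> exists2 i, i < n & t = drop i u.
  by rewrite mem_rev mem_sort => /mapP[i]; rewrite mem_iota add0n => lt_in ->; exists i.
exists ts; split.
- by rewrite size_rev size_sort size_map size_iota.
- have: sorted >%O ts.
    by rewrite rev_sorted lt_sorted_uniq_le sort_uniq uniq_tails sort_le_sorted.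
  apply: (sub_in_sorted (P := mem ts)); last by apply/allP.
  move=> t1 t2 /mem_ts[i lt_in ->] /mem_ts[j lt_jn ->] lt_ts.
  apply/andP; split; last exact: lt_ts.
  apply: cmp => //.
  by apply: contraTneq lt_ts => ->; rewrite /= ltxx.
by apply/allP => t /mem_ts[i _ ->]; rewrite suffix_drop.
Qed.

(** * Divisions from decreasing chains of factors *)

(** A pair [(i, t)] stands for an occurrence of the word [t] at position [i]. *)
Definition precedes (x y : nat * seq A) : bool :=
  (x.1 + size x.2 <= y.1) && wgt x.2 y.2.

(** Cutting at the marked positions gives blocks that start with the marked words;
    as these words do not overlap, they alone decide the comparisons. *)
Lemma divisible_of_chain W x s :
  all (fun y => prefix y.2 (drop y.1 W)) (x :: s) -> path precedes x s ->
  n_divisible (size s).+1 W.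
Proof.
move=> occ chain.
suff [us [eq_us sz_us sorted_us _]] : exists us : seq (seq A),
    [/\ drop x.1 W = flatten us, size us = (size s).+1, sorted wgt us
      & prefix x.2 (head [::] us)].
  exists (take x.1 W), (tcast sz_us (in_tuple us)).
  by rewrite val_tcast /= -eq_us cat_take_drop.
elim: s x occ chain => [|y s IHs] x /= /andP[/prefixP[r eq_r] occ].
  by move=> _; exists [:: drop x.1 W]; rewrite /= cats0 eq_r prefix_prefix.
case/andP=> /andP[le_xy gt_xy] chain.
have le_x1 : x.1 <= y.1 := leq_trans (leq_addr _ _) le_xy.
have le_x2 : size x.2 <= y.1 - x.1 by rewrite leq_subRL.
have [[|u us] [eq_us // sz_us sorted_us pre_u]] := IHs y occ chain.
exists (take (y.1 - x.1) (drop x.1 W) :: u :: us); split.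
- by rewrite -[LHS](cat_take_drop (y.1 - x.1)) drop_drop subnK // eq_us.
- by move: sz_us => /= [->].
- rewrite /= andbC; apply/andP; split=> //.
  case/prefixP: pre_u => r' /= ->; rewrite eq_r take_cat ltnNge le_x2 /=.
  exact: wgt_cat.
- rewrite eq_r take_cat ltnNge le_x2 /=.
  exact: prefix_prefix.
Qed.

Definition window W k i : seq A := take k (drop i W).

Lemma size_window W k i : i + k <= size W -> size (window W k i) = k.
Proof. by move=> le; rewrite size_takel // size_drop; lia. Qed.

Lemma window_prefix W k i : prefix (window W k i) (drop i W).
Proof. exact: prefix_take. Qed.

Lemma window_add W k m i :
  window W (k + m) i = window W k i ++ window W m (i + k).
Proof. by rewrite /window takeD drop_drop addnC. Qed.

Lemma window_wgt W k K i j : k <= K ->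
  wgt (window W k i) (window W k j) -> wgt (window W K i) (window W K j).
Proof.
by move=> le_k gt_ij; apply: (@wgt_take k); rewrite !take_takel.
Qed.

(** The [m]-th largest of the longest tails of [u] is marked in the [m]-th
    occurrence of [u]. *)
Lemma repeated_word W u d q qs :
  ~ contains_power d W -> 0 < d -> (size qs).+1 * d <= size u ->
  all (fun i => prefix u (drop i W)) (q :: qs) ->
  path (fun i j => i + size u <= j) q qs ->
  n_divisible (size qs).+1 W.
Proof.
move=> nopow d0 le_u occ far.
have nopow_u : ~ contains_power d u.
  case=> x x0 pow_x; apply: nopow; exists x => //.
  apply: infix_trans pow_x _; case/andP: occ => /prefix_infix_trans occ _.
  exact/occ/infix_drop.
have [[|t ts] [// [sz_ts] sorted_ts suf]] := decreasing_tails nopow_u d0 le_u.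
pose mark i t := (i + (size u - size t), t).
pose s := [seq mark x.1 x.2 | x <- zip qs ts].
have sz_s : size s = size qs by rewrite size_map size1_zip // sz_ts.
rewrite -sz_s; apply: (@divisible_of_chain W (mark q t)).
  have occ_mark i t' : prefix u (drop i W) -> suffix t' u ->
      prefix t' (drop (i + (size u - size t')) W).
    case/prefixP=> r eq_r /suffixP[r' eq_u].
    have -> : size u - size t' = size r' by rewrite eq_u size_cat addnK.
    rewrite addnC -drop_drop eq_r eq_u -catA drop_size_cat //.
    exact: prefix_prefix.
  rewrite {sorted_ts far le_u nopow_u sz_s}/s.
  elim: qs ts q t sz_ts occ suf => [|q' qs IH] [|t' ts] q t //=.
    by move=> _ /andP[occ _] /andP[suf _]; rewrite occ_mark.
  by move=> [sz] /andP[occ occs] /andP[suf sufs]; rewrite occ_mark //=; apply: IH.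
rewrite {occ le_u nopow_u sz_s}/s.
elim: qs ts q t sz_ts far sorted_ts suf => [|q' qs IH] [|t' ts] q t //= [sz].
move=> /andP[far fars] /andP[gt gts] /andP[suf sufs].
rewrite IH // andbT /precedes /= gt andbT.
by rewrite -addnA subnK ?size_suffix // (leq_trans far) ?leq_addr.
Qed.

(** * Uniform intervals *)

Section Colouring.
Variables (W : seq A) (K p : nat).

Definition far_drop i j : bool :=
  [&& i + K <= j, j + K <= size W & wgt (window W K i) (window W K j)].

Lemma colouring : ~ n_divisible p.+2 W ->
  exists col : nat -> 'I_p.+1, forall i j, far_drop i j -> col i != col j.
Proof.
move=> ndiv; apply: longest_path_colouring => i s sz_s.
apply/negP => chain; apply: ndiv; rewrite -sz_s.
pose mark j := (j, window W K j).
rewrite -(size_map mark s); apply: (@divisible_of_chain W (mark i)).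
  by rewrite -map_cons all_map; apply/allP => j _; apply: window_prefix.
rewrite path_map; apply: sub_path chain => j k /and3P[le_jk le_k gt_jk].
rewrite /precedes /= gt_jk size_window ?le_jk //; lia.
Qed.

Variable col : nat -> 'I_p.+1.
Hypothesis colP : forall i j, far_drop i j -> col i != col j.

(** The first clause makes every position of the interval start a factor of
    length [K]. *)
Definition uniform k a L : Prop :=
  a + L + K <= size W /\
  forall i j, a <= i < a + L -> a <= j < a + L -> col i = col j ->
    window W k i = window W k j.

(** Among the blocks of length [L] separated by gaps of length [L], each
    non-uniform one has two positions of the same colour with different factors of
    length [k].  If the larger factors in two such blocks start at positions with the
    same key, the larger factor of the earlier block and the smaller factor of the
    later one form a far drop within one colour.  So the number of
    non-uniform blocks is at most the number of keys. *)
Lemma uniform_block (T : finType) (key : nat -> T) k a L M :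
  k <= K <= L -> #|T| < M -> a + 2 * L * M <= size W ->
  (forall i j, a <= i -> a <= j -> i + L < a + 2 * L * M -> j + L < a + 2 * L * M ->
     key i = key j -> col i = col j /\ window W k i = window W k j) ->
  exists a', [/\ a <= a', a' + L <= a + 2 * L * M & uniform k a' L].
Proof.
move=> /andP[le_kK le_KL] lt_TM le_W keyP.
apply: contrapT => nouniform.
(* Block [b] consists of the positions [i] with [st b <= i < st b + L]. *)
pose st b := a + 2 * L * b.
have st_le b : b < M -> st b + 2 * L <= a + 2 * L * M.
  by move=> lt_bM; rewrite /st -addnA -mulnSr leq_add2l leq_mul2l lt_bM orbT.
have bad (b : 'I_M) : exists x : nat * nat,
    [/\ st b <= x.1 < st b + L, st b <= x.2 < st b + L, col x.1 = col x.2
      & wgt (window W k x.1) (window W k x.2)].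
  apply: contrapT => nobad; apply: nouniform; exists (st b).
  have := st_le b (ltn_ord b) => le_b.
  split; [by rewrite leq_addr | lia | split; first lia].
  move=> i j bi bj eq_col; apply/eqP; apply: contrapT => /negP neq.
  have: wgt (window W k i) (window W k j) || wgt (window W k j) (window W k i).
    by apply: wgt_total => //; rewrite !size_window //; lia.
  by case/orP => gt; apply: nobad; [exists (i, j) | exists (j, i)].
(* [(x b).1] starts the larger and [(x b).2] the smaller of the two factors. *)
have [x xP] := choice bad.
suff inj : injective (fun b => key (x b).1).
  by have := leq_card _ inj; rewrite card_ord leqNgt lt_TM.
suff lt_key (b c : 'I_M) : b < c -> key (x b).1 <> key (x c).1.
  move=> b c eq_key; apply: val_inj; case: (ltngtP (val b) (val c)) => // lt.
    by have := lt_key b c lt; rewrite eq_key.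
  by have := lt_key c b lt; rewrite eq_key.
move=> lt_bc; have [b1 _ _ _] := xP b; have [c1 c2 eq_c gt_c] := xP c.
have le_b := st_le b (ltn_ord b); have le_c := st_le c (ltn_ord c).
have le_bc : st b + 2 * L <= st c.
  by rewrite /st -addnA -mulnSr leq_add2l leq_mul2l lt_bc orbT.
have a_b : a <= st b by rewrite leq_addr.
move=> /keyP[]; [lia..|] => eq_col eq_win.
suff /colP : far_drop (x b).1 (x c).2 by rewrite eq_col eq_c eqxx.
apply/and3P; split; [lia | lia |].
by apply: window_wgt le_kK _; rewrite eq_win.
Qed.

(** The key is the colour and the letter; [option A] only serves to avoid a
    default letter. *)
Lemma uniform_letter L :
  0 < K <= L -> 2 * L * (p.+2 * #|A|.+1) <= size W -> exists a, uniform 1 a L.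
Proof.
move=> /andP[K0 le_KL] le_W.
pose key i := (col i, ohead (drop i W)).
have [| | | |a [_ _ uni]] :=
  @uniform_block _ key 1 0 L (p.+2 * #|A|.+1) _ _ _ _; last by exists a.
- by rewrite K0.
- by rewrite card_prod card_ord card_option ltn_mul2r /=.
- by [].
- move=> i j _ _ _ _ [-> eq_hd]; split=> //; rewrite /window.
  by case: (drop i W) (drop j W) eq_hd => [|x s] [|y t] //= [->]; rewrite !take0.
Qed.

(** In a [k]-uniform interval the colours of [i] and [i + k] determine the two
    halves of the factor of length [2 k] at [i]. *)
Lemma uniform_double k a L :
  k + k <= K <= L -> uniform k a (2 * L * p.+2 ^ 2) ->
  exists a', uniform (k + k) a' L.
Proof.
move=> /andP[le_kK le_KL] [le_W uni].
pose key i := (col i, col (i + k)).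
have [| | | |a' [_ _ uni']] :=
  @uniform_block _ key (k + k) a L (p.+2 ^ 2) _ _ _ _; last by exists a'.
- by rewrite le_kK.
- by rewrite card_prod !card_ord; lia.
- lia.
- move=> i j ai aj iM jM [eq_col eq_col']; split=> //.
  by rewrite !window_add; congr (_ ++ _); apply: uni => //; lia.
Qed.

Lemma uniform_pow2 L j : 2 ^ j <= K <= L -> 0 < K ->
  2 * ((2 * p.+2 ^ 2) ^ j * L) * (p.+2 * #|A|.+1) <= size W ->
  exists a, uniform (2 ^ j) a L.
Proof.
elim: j L => [|j IHj] L /andP[le_jK le_KL] K0 le_W.
  by apply: uniform_letter; [rewrite K0 | move: le_W; rewrite expn0 mul1n].
have le2j : 2 ^ j + 2 ^ j <= K by rewrite addnn -mul2n -expnS.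
have [| | |a /uniform_double] := IHj (2 * L * p.+2 ^ 2).
- apply/andP; split; first lia.
  by apply: leq_trans le_KL _; rewrite mulnAC leq_pmull.
- by [].
- suff <- : (2 * p.+2 ^ 2) ^ j.+1 * L = (2 * p.+2 ^ 2) ^ j * (2 * L * p.+2 ^ 2) by [].
  by rewrite expnSr -mulnA [2 * L * _]mulnAC.
rewrite addnn -mul2n -expnS; apply; lia.
Qed.

(** Among [p.+2 ^ 2] positions spaced by [K], more than [p.+1] share one of the
    [p.+1] colours, hence the factor of length [K], and [repeated_word] applies. *)
Lemma uniform_full a d : ~ contains_power d W -> 0 < d -> p.+2 * d <= K ->
  uniform K a (K * p.+2 ^ 2) -> n_divisible p.+2 W.
Proof.
move=> nopow d0 le_K [le_W uni].
pose pos (b : nat) := a + K * b.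
have [|c lt_c] := @frequent_value _ _ (fun b => col (pos b)) p.+1 (iota 0 (p.+2 ^ 2)).
  by rewrite card_ord size_iota; lia.
pose bs := take p.+2 [seq b <- iota 0 (p.+2 ^ 2) | col (pos b) == c].
have sz_bs : size bs = p.+2 by rewrite size_takel // size_filter.
have bs_sorted : sorted ltn bs.
  exact/take_sorted/sorted_filter/iota_ltn_sorted/ltn_trans.
have bs_mem (b : nat) : b \in bs -> col (pos b) = c /\ a <= pos b < a + K * p.+2 ^ 2.
  move=> /mem_take; rewrite mem_filter mem_iota add0n => /andP[/eqP-> /= lt_b].
  split=> //; rewrite /pos leq_addr ltn_add2l ltn_pmul2l //.
  by apply: leq_trans le_K; rewrite muln_gt0.
case: bs sz_bs bs_sorted bs_mem => [//|b bs] /= [sz_bs] bs_sorted bs_mem.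
have [col_b in_b] := bs_mem b (mem_head _ _).
have sz_u : size (window W K (pos b)) = K by rewrite size_window //; lia.
rewrite -sz_bs -(size_map pos); apply: (@repeated_word W (window W K (pos b)) d (pos b)).
- by [].
- by [].
- by rewrite size_map sz_bs sz_u.
- rewrite -map_cons all_map; apply/allP => b' /bs_mem[col_b' in_b'] /=.
  by rewrite (uni (pos b) (pos b')) ?window_prefix // col_b col_b'.
- rewrite path_map sz_u; apply: sub_path bs_sorted => i j /= lt_ij.
  by rewrite /pos -addnA -mulnSr leq_add2l leq_mul2l lt_ij orbT.
Qed.

End Colouring.

(** * The length bound *)

(** For [n = 1] every word is a division of itself; the colourings above need
    [n >= 2], as they have [n - 1 > 0] colours. *)
Lemma divisible_or_power W n d j :
  0 < n -> 0 < d -> n * d <= 2 ^ j ->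
  2 * ((2 * n ^ 2) ^ j * (2 ^ j * n ^ 2)) * (n * #|A|.+1) <= size W ->
  contains_power d W \/ n_divisible n W.
Proof.
move=> n0 d0 le_j le_W.
have [|nopow] := EM (contains_power d W); [by left | right].
case: n n0 le_j le_W => [//|[|p]] _ le_j le_W.
  by exists [::], [tuple W]; rewrite /= cats0.
apply: contrapT => ndiv.
have [col colP] := colouring (2 ^ j) ndiv.
have [||//|a uni] := uniform_pow2 colP (L := 2 ^ j * p.+2 ^ 2) (j := j).
- by rewrite leqnn leq_pmulr // expn_gt0.
- by rewrite expn_gt0.
- exact: ndiv (uniform_full nopow d0 le_j uni).
Qed.

Lemma length_bound_le (n d l t : nat) : 0 < n -> 0 < d -> 0 < l -> 2 ^ t <= n * d ->
  2 * ((2 * n ^ 2) ^ t.+1 * (2 ^ t.+1 * n ^ 2)) * (n * l.+1) <=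
  256 * l * (n * d) ^ (2 * t + 10) * d ^ 2.
Proof.
move=> n0 d0 l0 le_t.
have -> : 2 * ((2 * n ^ 2) ^ t.+1 * (2 ^ t.+1 * n ^ 2)) * (n * l.+1)
    = 8 * l.+1 * n ^ (2 * t + 5) * (2 ^ t) ^ 2.
  have -> : n ^ (2 * t + 5) = n ^ (2 * t.+1) * n ^ 3 by rewrite -expnD; congr expn; lia.
  rewrite expnMn -expnM (expnS 2 t); move: (2 ^ t) (n ^ (2 * t.+1)) => x y; nia.
have h1 : (2 ^ t) ^ 2 <= (n * d) ^ 2 by rewrite leq_exp2r.
have h2 : n ^ (2 * t + 5) <= (n * d) ^ (2 * t + 8).
  apply: (@leq_trans ((n * d) ^ (2 * t + 5))).
    by rewrite leq_exp2r ?leq_pmulr // addnS.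
  by rewrite leq_pexp2l ?muln_gt0 ?n0 // leq_add2l.
have h3 : 8 * l.+1 <= 256 * l by lia.
apply: (leq_trans (leq_mul (leq_mul h3 h2) h1)).
by rewrite -[_ * _ ^ _ * _]mulnA -expnD -addnA leq_pmulr // expn_gt0 d0.
Qed.

End Combinatorics.

Local Open Scope ring_scope.

(** [t <= log2 (n * d)], so replacing the logarithm in the exponent by [t] only
    decreases the bound. *)
Lemma Psi_ge_nat (R : realType) (n d l t : nat) :
  (0 < n)%N -> (0 < d)%N -> (2 ^ t <= n * d)%N ->
  (256 * l * (n * d) ^ (2 * t + 10) * d ^ 2)%:R <= Psi R n d l.
Proof.
move=> n0 d0 le_t; rewrite /Psi.
rewrite natrM natrX [X in X * _]natrM natrX [X in X * _ * _]natrM.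
have nd1 : (1 : R) <= (n * d)%:R by rewrite ler1n muln_gt0 n0.
have ln2 : 0 < ln (2 : R) by rewrite ln_gt0 // ltr1n.
rewrite ler_wpM2r ?exprn_ge0 // ler_wpM2l ?mulr_ge0 //.
rewrite -powR_mulrn ?ler0n // ler_powR // natrD natrM lerD2r.
rewrite ler_wpM2l // /log2 ler_pdivlMr // mulr_natl -lnXn //.
by rewrite ler_ln ?posrE ?exprn_gt0 ?(lt_le_trans ltr01 nd1) // -natrX ler_nat.
Qed.

Theorem mainTheorem6 (R : realType) (l n d : nat)
    (disp : Order.disp_t) (A : finOrderType disp)
    (hl : (0 < l)%N) (hn : (0 < n)%N) (hd : (0 < d)%N) (hnd : (n <= d)%N)
    (hA : #|A| = l) (W : seq A) (hW : Psi R n d l <= (size W)%:R) :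
  contains_power d W \/ n_divisible n W.
Proof.
have nd0 : (0 < n * d)%N by rewrite muln_gt0 hn.
have /andP[le_t lt_b] := trunc_log_bounds (isT : (1 < 2)%N) nd0.
apply: (@divisible_or_power _ A W n d (trunc_log 2 (n * d)).+1) => //.
  exact: ltnW.
rewrite hA; apply: leq_trans (length_bound_le hn hd hl le_t) _.
by rewrite -(ler_nat R); apply: le_trans hW; apply: Psi_ge_nat.
Qed.
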